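(* Let $X$ be a real Hilbert space, let $m\in\{2,3,\ldots\}$, and let $R_1,\ldots,R_m\colon X\to X$ be nonexpansive. Then the following equivalences hold, running over all cyclic shifts of the composition: $$\operatorname{v}_{R_mR_{m-1}\cdots R_1}\in\operatorname{ran}(\operatorname{Id}-R_mR_{m-1}\cdots R_1)$$ $$\Leftrightarrow\ \operatorname{v}_{R_{m-1}\cdots R_1R_m}\in\operatorname{ran}(\operatorname{Id}-R_{m-1}\cdots R_1R_m)$$ $$\Leftrightarrow\ \cdots\ \Leftrightarrow\ \operatorname{v}_{R_1R_m\cdots R_2}\in\operatorname{ran}(\operatorname{Id}-R_1R_m\cdots R_2).$$
   Context: $X$ is a real Hilbert space with induced norm $\|\cdot\|$; $\operatorname{Id}$ is the identity on $X$; products of operators denote composition; $\operatorname{ran}(T)$ is the range of $T$ and $\overline{\operatorname{ran}}(T)$ its norm closure. The cyclic shifts of $R_mR_{m-1}\cdots R_1$ are the $m$ compositions $R_kR_{k-1}\cdots R_1R_mR_{m-1}\cdots R_{k+1}$, $k\in\{1,\ldots,m\}$ (for $k=m$ this is $R_m\cdots R_1$). A map $R\colon X\to X$ is nonexpansive if $\|Rx-Ry\|\leq\|x-y\|$ for all $x,y\in X$. For $R$ nonexpansive, $\overline{\operatorname{ran}}(\operatorname{Id}-R)$ is nonempty, closed and convex, and the minimal displacement vector of $R$ is $\operatorname{v}_R=P_{\overline{\operatorname{ran}}(\operatorname{Id}-R)}(0)$, where $P_C$ denotes the metric projection onto a nonempty closed convex set $C$. *)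

(* Defs.v *)
From HB Require Import structures.
From mathcomp Require Import all_boot all_order all_algebra.
From mathcomp Require Import all_classical all_reals all_analysis.

Set Implicit Arguments.
Unset Strict Implicit.
Unset Printing Implicit Defensive.

Import Order.TTheory GRing.Theory Num.Theory.
Import numFieldNormedType.Exports.

Local Open Scope classical_set_scope.
Local Open Scope ring_scope.

Definition nonexpansive (K : realType) (X : normedModType K) (T : X -> X) : Prop :=
  forall x y : X, `|T x - T y| <= `|x - y|.

Definition is_nearest_point (K : realType) (X : normedModType K)
    (C : set X) (x p : X) : Prop :=
  C p /\ forall c : X, C c -> `|x - p| <= `|x - c|.

(* [get] returns the nearest point whenever there is exactly one, as is the
   case for a nonempty closed convex subset of a Hilbert space; the value is
   meaningless when there is none. *)
Definition metric_proj (K : realType) (X : normedModType K)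
    (C : set X) (x : X) : X :=
  get [set p | is_nearest_point C x p].

Definition ran_displacement (K : realType) (X : normedModType K)
    (T : X -> X) : set X :=
  range (fun x => x - T x).

Definition min_displacement (K : realType) (X : normedModType K)
    (T : X -> X) : X :=
  metric_proj (closure (ran_displacement T)) 0.

(* [R i] stands for R_(i+1).  For 1 <= k <= m, the list below is
   [:: k-1; ...; 0; m-1; ...; k], so that the result is
   R_k ... R_1 R_m ... R_(k+1), the rightmost factor being applied first. *)
Definition cyclic_shift (X : Type) (m : nat) (R : 'I_m -> X -> X) (k : nat) :
    X -> X :=
  foldr (fun i f => R i \o f) id (rot (m - k) (rev (enum 'I_m))).

(* Main.v *)
(* For nonexpansive T, points x with |x - T x| near its infimum d have nearly
   equal displacements: each x - T x is close to p - T p, where p solves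
   s p + (p - T p) = 0 with s small, because Id - T is monotone.  By completeness
   the closure of ran (Id - T) has exactly one element of least norm, so v_T lies
   in ran (Id - T) iff some x minimises |x - T x|.  If x minimises the
   displacement of A B, then B x minimises that of B A, since
   |B x - B A B x| <= |x - A B x| <= |A y - A B A y| <= |y - B A y|.
   Any two cyclic shifts are related in this way to the unshifted composition. *)
Require Import Defs.
From HB Require Import structures.
From mathcomp Require Import all_boot all_order all_algebra.
From mathcomp Require Import all_classical all_reals all_analysis.
From mathcomp Require Import ring lra.

Set Implicit Arguments.
Unset Strict Implicit.
Unset Printing Implicit Defensive.

Import Order.TTheory GRing.Theory Num.Theory.
Import numFieldNormedType.Exports.

Local Open Scope classical_set_scope.
Local Open Scope ring_scope.

(** * Nearest points as limits of almost minimal elements *)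

Lemma closure_normP (K : realType) (X : normedModType K) (C : set X) (p : X) :
  closure C p <-> forall e : K, 0 < e -> exists2 c, C c & `|p - c| < e.
Proof.
split=> [Cp e e0|near_p B /nbhs_ballP[e /= e0 peB]].
  have [c [Cc pc]] := Cp _ (nbhsx_ballx p e e0).
  by exists c => //; move: pc; rewrite -ball_normE.
have [c Cc pc] := near_p e e0; exists c; split=> //.
by apply: peB; rewrite -ball_normE.
Qed.

(** The third hypothesis says that the elements of [C] of norm below [d + r] form a Cauchy filter
    base as [r] tends to 0; its limit has norm [d]. Stated this way, convexity of the closure never
    has to be proved. *)
Lemma minimizing_cauchy_unique_nearest (K : realType)
    (X : completeNormedModType K) (C : set X) (d : K) :
    (forall c, C c -> d <= `|c|) ->
    (forall e : K, 0 < e -> exists2 c, C c & `|c| < d + e) ->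
    (forall e : K, 0 < e -> exists2 r : K, 0 < r & forall a b, C a -> C b ->
      `|a| < d + r -> `|b| < d + r -> `|a - b| < e) ->
  exists2 p, is_nearest_point (closure C) 0 p &
    forall q, is_nearest_point (closure C) 0 q -> q = p.
Proof.
move=> d_lb d_approx C_cauchy.
pose B r := [set c | C c /\ `|c| < d + r].
pose F := filter_from [set r : K | 0 < r] B.
have F_filter : Filter F.
  apply: filter_from_filter; first by exists 1 => /=.
  move=> r s /= r0 s0; exists (Num.min r s); first by rewrite /= lt_min r0.
  move=> c [Cc cd]; have mr : Num.min r s <= r by rewrite ge_min lexx.
  have ms : Num.min r s <= s by rewrite ge_min lexx orbT.
  by split; split=> //; apply: lt_le_trans cd _; rewrite lerD2l.
have F_proper : ProperFilter F.
  apply: filter_from_proper => r /= r0.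
  by have [c Cc cd] := d_approx r r0; exists c.
have F_cvg : cvg F.
  apply: cauchy_cvg; apply/cauchy_ballP => e e0.
  have [r r0 Br] := C_cauchy e e0.
  exists (B r, B r); first by split; exists r.
  move=> [a b] [/= [Ca ad] [Cb bd]].
  by rewrite -ball_normE /=; exact: Br.
pose p : X := lim F; have Fp : F --> p by exact: F_cvg.
(* Some elements of [C] are at once close to [p] and almost minimal. *)
have closeC e r : 0 < e -> 0 < r ->
    exists2 c, C c & `|p - c| < e /\ `|c| < d + r.
  move=> e0 r0; have /Fp [s /= s0 Bs] := nbhsx_ballx p e e0.
  have m0 : 0 < Num.min r s by rewrite lt_min r0.
  have [c Cc cd] := d_approx _ m0; exists c => //; split.
    have : ball p e c.
      by apply: Bs; split=> //; apply: lt_le_trans cd _;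
        rewrite lerD2l ge_min lexx orbT.
    by rewrite -ball_normE.
  by apply: lt_le_trans cd _; rewrite lerD2l ge_min lexx.
have Cp : closure C p.
  by apply/closure_normP => e e0; have [c Cc [pc _]] := closeC e 1 e0 ltr01;
    exists c.
have le_d : `|p| <= d.
  apply/ler_addgt0Pr => e e0; have e20 : 0 < e / 2 by lra.
  have [c _ [pc cd]] := closeC _ _ e20 e20.
  by have := ler_normD (p - c) c; rewrite subrK; lra.
have d_le q : closure C q -> d <= `|q|.
  move=> /closure_normP Cq; apply/ler_addgt0Pr => e e0.
  have [c Cc qc] := Cq e e0; have := d_lb c Cc.
  by have := ler_normB q (q - c); rewrite subKr; lra.
exists p; first split=> // q Cq.
  by rewrite !sub0r !normrN; exact: le_trans le_d (d_le q Cq).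
(* A nearest point [q] has norm at most [d], so elements [b] of [C] near [q] are almost minimal,
   hence close to the almost minimal [a] near [p]. *)
move=> q [/closure_normP Cq q_min]; apply/eqP; rewrite -subr_eq0 -normr_eq0.
rewrite eq_le normr_ge0 andbT; apply/ler_addgt0Pr => e e0.
have := q_min p Cp; rewrite !sub0r !normrN => qp.
have e30 : 0 < e / 3 by lra.
have [r r0 Br] := C_cauchy _ e30.
have m0 : 0 < Num.min (e / 3) r by rewrite lt_min e30.
have [a Ca [pa ad]] := closeC _ _ e30 r0.
have [b Cb] := Cq _ m0; rewrite lt_min => /andP[qb qbr].
have bd : `|b| < d + r by have := ler_normB q (q - b); rewrite subKr; lra.
have ab := Br a b Ca Cb ad bd.
have -> : q - p = (q - b) - ((p - a) + (a - b)).
  by rewrite addrA subrK opprB addrA subrK.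
by have := ler_normB (q - b) ((p - a) + (a - b));
  have := ler_normD (p - a) (a - b); lra.
Qed.

(* The zero of [s Id + (Id - T)] is a fixed point of the contraction
   [T / (1 + s)]. *)
Lemma nonexpansive_resolvent (K : realType) (X : completeNormedModType K)
    (T : X -> X) (s : K) :
  nonexpansive T -> 0 < s -> exists p, p - T p = - (s *: p).
Proof.
move=> T_nonexp s0; pose q : K := (1 + s)^-1.
have q0 : 0 <= q by rewrite invr_ge0; lra.
have q1 : q < 1 by rewrite invf_lt1; lra.
pose f : X -> X := fun x => q *: T x.
have f_fun : set_fun setT setT f by [].
pose fF : {fun setT >-> setT} := mkfun_fun f_fun.
have fF_ctr : is_contraction fF.
  exists (NngNum q0); split=> //= -[x y] _ /=.
  by rewrite /f -scalerBr normrZ ger0_norm // ler_wpM2l.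
have [p _ p_fix] := banach_fixed_point fF_ctr closedT (ex_intro _ (0 : X) I).
exists p; have : (1 + s) *: p = T p.
  by rewrite [in LHS]p_fix /= /f scalerA mulfV ?scale1r //; lra.
by move=> <-; rewrite scalerDl scale1r opprD addrA subrr add0r.
Qed.

(** * Displacements of nonexpansive maps in a Hilbert space *)

Section InnerProduct.
Variables (K : realType) (X : completeNormedModType K).
Variable dotp : {dot X for idfun}.
Hypothesis norm_dotp : forall x : X, `|x| = Num.sqrt (dotp x x).

(* [dotp] read as a map [X -> X -> K], so that [ring] and [lra] see a single
   scalar structure. *)
Definition inner (x y : X) : K := dotp x y.

Lemma innerC x y : inner x y = inner y x.
Proof. by rewrite /inner hermC /= expr0 mul1r. Qed.

Lemma innerNr x y : inner x (- y) = - inner x y.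
Proof. by rewrite /inner linearNr. Qed.

Lemma innerBr x y z : inner x (y - z) = inner x y - inner x z.
Proof. by rewrite /inner linearBr. Qed.

Lemma innerBl x y z : inner (x - y) z = inner x z - inner y z.
Proof. by rewrite !(innerC _ z) innerBr. Qed.

Lemma innerZr a x y : inner x (a *: y) = a * inner x y.
Proof. by rewrite /inner linearZr_LR. Qed.

Lemma inner_norm x : inner x x = `|x| ^+ 2.
Proof.
rewrite norm_dotp sqr_sqrtr // /inner.
have [->|x0] := eqVneq x 0; first by rewrite linear0l.
exact/ltW/neq0_dnorm_gt0.
Qed.

Lemma sqr_normB x y : `|x - y| ^+ 2 = `|x| ^+ 2 - 2 * inner x y + `|y| ^+ 2.
Proof. by rewrite -!inner_norm innerBl !innerBr (innerC y x); ring. Qed.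

(** Parallelogram law for [z - x] and [z - y], with the square of their sum dropped. *)
Lemma sqr_normB_le (x y z : X) :
  `|x - y| ^+ 2 <= 2 * `|z - x| ^+ 2 + 2 * `|z - y| ^+ 2.
Proof.
have -> : x - y = (z - y) - (z - x) by rewrite opprB [RHS]addrC addrA subrK.
have := sqr_ge0 `|(z - y) - (- (z - x))|.
rewrite (sqr_normB (z - y) (z - x)) (sqr_normB (z - y) (- (z - x))).
by rewrite innerNr normrN; lra.
Qed.

(** By Cauchy-Schwarz in the form [2 <a, b> <= |a|^2 + |b|^2], where [|b| <= |a|]. *)
Lemma displacement_monotone (T : X -> X) x y : nonexpansive T ->
  0 <= inner ((x - T x) - (y - T y)) (x - y).
Proof.
move=> /(_ x y) Txy.
have -> : (x - T x) - (y - T y) = (x - y) - (T x - T y).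
  by rewrite !opprB [T y - y]addrC addrACA [- T x + _]addrC.
set a := x - y in Txy *; set b := T x - T y in Txy *.
rewrite innerBl inner_norm innerC.
have : `|b| ^+ 2 <= `|a| ^+ 2 by rewrite ler_sqr ?nnegrE.
by have := sqr_ge0 `|a - b|; rewrite sqr_normB; lra.
Qed.

(* With [u = p - T p = - s p] and [w = x - T x], monotonicity reads
   [<u - w, u> <= - s <u - w, x>], so that [w] is close to [u] for small [s]
   when [|w|] is nearly minimal. *)
Lemma resolvent_dist (T : X -> X) (s : K) p x : nonexpansive T -> 0 < s ->
    p - T p = - (s *: p) ->
  (1 - s) * `|(p - T p) - (x - T x)| ^+ 2 <=
  `|x - T x| ^+ 2 - `|p - T p| ^+ 2 + s * `|x| ^+ 2.
Proof.
move=> T_nonexp s0 pE.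
have := displacement_monotone p x T_nonexp.
set u := p - T p in pE *; set w := x - T x => mono.
have {}mono : inner (u - w) u + s * inner (u - w) x <= 0.
  have : 0 <= s * inner (u - w) (p - x) by rewrite mulr_ge0 // ltW.
  have : inner (u - w) u = - (s * inner (u - w) p).
    by rewrite [in X in inner _ X]pE innerNr innerZr.
  by rewrite (innerBr _ p x) mulrBr; lra.
have w2 : `|w| ^+ 2 = `|u| ^+ 2 - 2 * inner (u - w) u + `|u - w| ^+ 2.
  by rewrite innerC -sqr_normB subKr.
(* The bracket is [|u - w + x|^2]; it bounds the cross term of [mono]. *)
have : 0 <= s * (`|u - w| ^+ 2 + 2 * inner (u - w) x + `|x| ^+ 2).
  rewrite mulr_ge0 ?(ltW s0) //.
  have := sqr_ge0 `|(u - w) - (- x)|.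
  by rewrite (sqr_normB (u - w)) innerNr normrN; lra.
by rewrite w2; move: mono; lra.
Qed.

(** Both displacements are compared with that of one resolvent point [p], whose norm is at least
    [d]. *)
Lemma minimizing_displacement_dist (T : X -> X) (d e : K) x y :
    nonexpansive T -> 0 <= d -> (forall z, d <= `|z - T z|) -> 0 < e ->
    `|x - T x| ^+ 2 <= d ^+ 2 + e -> `|y - T y| ^+ 2 <= d ^+ 2 + e ->
  `|(x - T x) - (y - T y)| ^+ 2 <= 16 * e.
Proof.
move=> T_nonexp d0 d_lb e0 xd yd.
(* This [s] gives both [s <= 1 / 2] and [s * (|x|^2 + |y|^2) <= e / 2]. *)
pose M := 2 * (e + `|x| ^+ 2 + `|y| ^+ 2); pose s := e / M.
have x2 := sqr_ge0 `|x|; have y2 := sqr_ge0 `|y|.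
have M0 : 0 < M by rewrite /M; lra.
have s0 : 0 < s by exact: divr_gt0.
have sM : s * M = e by rewrite /s divfK // gt_eqF.
have [p pE] := nonexpansive_resolvent T_nonexp s0.
have dp : d ^+ 2 <= `|p - T p| ^+ 2 by rewrite ler_sqr ?nnegrE.
have := resolvent_dist x T_nonexp s0 pE.
have := resolvent_dist y T_nonexp s0 pE.
set u := p - T p in dp *.
set wx := x - T x in xd *; set wy := y - T y in yd *.
have := sqr_normB_le wx wy u.
have sx : 0 <= s * `|x| ^+ 2 by rewrite mulr_ge0 // ltW.
have sy : 0 <= s * `|y| ^+ 2 by rewrite mulr_ge0 // ltW.
have se : 0 <= s * e by rewrite mulr_ge0 // ltW.
have sMe : s * e * 2 + s * `|x| ^+ 2 * 2 + s * `|y| ^+ 2 * 2 = e.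
  by rewrite -[RHS]sM /M; ring.
have s2 : s <= 1 / 2.
  by rewrite -(ler_pM2r e0); lra.
move: (sqr_ge0 `|u - wx|) (sqr_ge0 `|u - wy|).
set ax := `|u - wx| ^+ 2; set ay := `|u - wy| ^+ 2 => ax0 ay0 h1 h2 h3.
have : 0 <= (1 / 2 - s) * ax by rewrite mulr_ge0 //; lra.
have : 0 <= (1 / 2 - s) * ay by rewrite mulr_ge0 //; lra.
lra.
Qed.

Lemma min_displacement_unique (T : X -> X) : nonexpansive T ->
  exists2 p, is_nearest_point (closure (ran_displacement T)) 0 p &
    forall q, is_nearest_point (closure (ran_displacement T)) 0 q -> q = p.
Proof.
move=> T_nonexp; pose N : set K := range (fun x => `|x - T x|).
have N0 : N !=set0 by exists `|0 - T 0|; exists 0.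
have N_lb : lbound N 0 by move=> _ [x _ <-].
have d0 : 0 <= inf N by exact: lb_le_inf.
have d_lb x : inf N <= `|x - T x| by apply: ge_inf; [exists 0 | exists x].
apply: (@minimizing_cauchy_unique_nearest _ _ _ (inf N)).
- by move=> _ [x _ <-].
- move=> e e0; have [|_ [x _ <-] xe] := @inf_adherent _ N e e0.
    by split=> //; exists 0.
  by exists (x - T x) => //; exists x.
(* The bound [16 * k] is then [e^2 / 2], strictly below [e^2]. *)
move=> e e0; pose k := e ^+ 2 / 32.
have e2 : 0 < e ^+ 2 by rewrite exprn_gt0.
have k0 : 0 < k by rewrite /k; lra.
have D0 : 0 < 2 * inf N + 1 + k by lra.
(* The summand [k] below forces [r <= 1], whence [(inf N + r)^2 <= (inf N)^2 + r * (2 * inf N + 1)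
   <= (inf N)^2 + k]. *)
pose r := k / (2 * inf N + 1 + k).
have r0 : 0 < r by exact: divr_gt0.
have rD : r * (2 * inf N + 1 + k) = k by rewrite /r divfK // gt_eqF.
exists r => // _ _ [x _ <-] [y _ <-] xr yr.
have near z : `|z - T z| < inf N + r -> `|z - T z| ^+ 2 <= inf N ^+ 2 + k.
  move=> zr; apply: (@le_trans _ _ ((inf N + r) ^+ 2)).
    by have dz := d_lb z; rewrite ler_sqr ?nnegrE; lra.
  rewrite sqrrD -addrA lerD2l.
  have r1 : r <= 1 by rewrite -(ler_pM2r D0) rD; lra.
  have : 0 <= r * (1 - r) by rewrite mulr_ge0 //; lra.
  have : 0 <= r * k by rewrite mulr_ge0 // ltW.
  by move: rD; rewrite -mulr_natr !mulrDr; lra.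
have := minimizing_displacement_dist T_nonexp d0 d_lb k0 (near x xr) (near y yr).
move=> le; rewrite -ltr_sqr ?nnegrE ?(ltW e0) //; apply: le_lt_trans le _.
by rewrite /k; lra.
Qed.

(** A lower bound for the norm on the range extends to its closure, so a minimal displacement is a
    nearest point, and uniqueness identifies it with the value of [get]. *)
Lemma min_displacement_attained (T : X -> X) : nonexpansive T ->
  ran_displacement T (min_displacement T) <->
  exists x, forall y, `|x - T x| <= `|y - T y|.
Proof.
move=> T_nonexp; have [p p_near p_uniq] := min_displacement_unique T_nonexp.
have -> : min_displacement T = p by exact: get_unique.
have in_ran z : ran_displacement T (z - T z) by exists z.
split=> [[x _ xp]|[x x_min]].
  exists x => y; have := p_near.2 _ (subset_closure (in_ran y)).
  by rewrite !sub0r !normrN -xp.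
rewrite -(p_uniq (x - T x)) //; split; first exact: subset_closure.
move=> c /closure_normP Cc; rewrite !sub0r !normrN.
apply/ler_addgt0Pr => e e0; have [_ [y _ <-] cy] := Cc e e0.
by have := x_min y; have := ler_normB c (c - (y - T y)); rewrite subKr; lra.
Qed.

Lemma min_displacement_attained_comp (A B : X -> X) :
    nonexpansive A -> nonexpansive B ->
  ran_displacement (A \o B) (min_displacement (A \o B)) ->
  ran_displacement (B \o A) (min_displacement (B \o A)).
Proof.
move=> A_nonexp B_nonexp.
have AB_nonexp : nonexpansive (A \o B).
  by move=> x y; exact: le_trans (A_nonexp _ _) (B_nonexp _ _).
have BA_nonexp : nonexpansive (B \o A).
  by move=> x y; exact: le_trans (B_nonexp _ _) (A_nonexp _ _).
move=> /(min_displacement_attained AB_nonexp)[x x_min].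
apply/(min_displacement_attained BA_nonexp); exists (B x) => y.
apply: le_trans (B_nonexp _ _) _; apply: le_trans (x_min (A y)) _.
exact: A_nonexp.
Qed.

End InnerProduct.

(** * Compositions along lists and their rotations *)

Lemma nonexpansive_foldr_comp (K : realType) (X : normedModType K) (I : Type)
    (R : I -> X -> X) (s : seq I) :
  (forall i, nonexpansive (R i)) ->
  nonexpansive (foldr (fun i f => R i \o f) id s).
Proof.
move=> R_nonexp; elim: s => [|i s IHs] x y //=.
exact: le_trans (R_nonexp i _ _) (IHs x y).
Qed.

Lemma foldr_comp_cat (X I : Type) (R : I -> X -> X) (s t : seq I) :
  foldr (fun i f => R i \o f) id (s ++ t) =
  foldr (fun i f => R i \o f) id s \o foldr (fun i f => R i \o f) id t.
Proof. by elim: s => //= i s ->. Qed.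

Theorem proposition4p8 (K : realType) (X : completeNormedModType K)
    (dotp : {dot X for idfun})
    (norm_dotp : forall x : X, `|x| = Num.sqrt (dotp x x))
    (m : nat) (m_ge2 : (2 <= m)%N)
    (R : 'I_m -> X -> X) (R_nonexp : forall i : 'I_m, nonexpansive (R i))
    (k l : nat) (hk : (1 <= k <= m)%N) (hl : (1 <= l <= m)%N) :
  ran_displacement (cyclic_shift R k) (min_displacement (cyclic_shift R k)) <->
  ran_displacement (cyclic_shift R l) (min_displacement (cyclic_shift R l)).
Proof.
pose T := foldr (fun i f => R i \o f) id (rev (enum 'I_m)).
suff unrot j :
    ran_displacement (cyclic_shift R j) (min_displacement (cyclic_shift R j))
    <-> ran_displacement T (min_displacement T).
  by rewrite !unrot.
(* Cutting the list at [m - j] writes [T] as [A \o B] and the shift as [B \o A]. *)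
rewrite /T -[in X in _ <-> X](cat_take_drop (m - j) (rev (enum 'I_m))).
rewrite /cyclic_shift /rot !foldr_comp_cat.
by split; apply: (min_displacement_attained_comp norm_dotp);
  exact: nonexpansive_foldr_comp.
Qed.
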